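(* Let $0\le\rho_0\le\frac12\ln2$. For any $n\ge1$ and any $f:\{0,1\}^n\to\mathbb{R}_+$ with $\|f\|_2\ge e^{n\rho_0}\|f\|_1$ we have, for all $t\ge0$, $$\|T_t^{\otimes n}f\|_{p(t)}\le\|f\|_2,$$ where $$p(t)=1+e^{\int_0^tC(\tilde\rho(s)\vee0)\,ds},\qquad\tilde\rho(s)=2\rho_0-\ln\left(\frac{2}{1+e^{-2s}}\right).$$
   Context: $a\vee b=\max(a,b)$. $h(x)=-x\ln x-(1-x)\ln(1-x)$ is the binary entropy function (natural logarithm). The function $C:[0,\ln2]\to[2,2/\ln2]$ is defined by $C(\ln2-h(y))=\frac{2-4\sqrt{y(1-y)}}{\ln2-h(y)}$ for $y\in[0,1/2]$, with $C(0)=2$ by continuity (the case $y=1/2$). Norms are $\|f\|_p=(\mathbb{E}|f|^p)^{1/p}$ with respect to the uniform probability measure on $\{0,1\}^n$. $T_t$ acts on functions on $\{0,1\}$ by $T_tf(x)=f(x)\frac{1+e^{-t}}2+f(1-x)\frac{1-e^{-t}}2$, and $T_t^{\otimes n}$ is the corresponding product (tensor power) semigroup acting on functions on $\{0,1\}^n$. *)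

(* Defs.v *)
From mathcomp Require Import all_boot all_order all_algebra.
From mathcomp Require Import all_classical all_reals all_analysis.
From mathcomp Require Import ring lra.

Set Implicit Arguments.
Unset Strict Implicit.
Unset Printing Implicit Defensive.

Import Order.TTheory GRing.Theory Num.Theory.
Import numFieldNormedType.Exports.

Local Open Scope classical_set_scope.
Local Open Scope ring_scope.

Notation cube n := {ffun 'I_n -> bool}.

(* [ln 0 = 0], so [binent 0 = binent 1 = 0]. *)
Definition binent {R : realType} (x : R) : R :=
  - x * ln x - (1 - x) * ln (1 - x).

Lemma binent_lt {R : realType} (x y : R) :
  0 <= x -> x < y -> y <= 2^-1 -> binent x < binent y.
Proof.
rewrite le_eqVlt => /predU1P[<-|x0] xy y2.
  have l1 : ln y < 0 by apply: ln_lt0; apply/andP; split; lra.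
  have l2 : ln (1 - y) < 0 by apply: ln_lt0; apply/andP; split; lra.
  by rewrite /binent subr0 ln1 oppr0 mul0r mulr0 subr0; nra.
pose df (z : R) := ln (1 - z) - ln z.
have dh (z : R) : 0 < z -> z < 1 -> is_derive z 1 (@binent R) (df z).
  move=> z0 z1.
  have z1' : 0 < 1 - z by lra.
  have H1 : is_derive z 1 (@ln R) z^-1 by exact: is_derive1_ln.
  have H2 : is_derive (1 - z) 1 (@ln R) (1 - z)^-1 by exact: is_derive1_ln.
  have H3 : is_derive z 1 (@ln R \o (fun u => 1 - u)) ((1 - z)^-1 * (0 - 1)).
    by apply: is_derive1_comp.
  rewrite /binent; apply: is_derive_eq.
  rewrite /df /GRing.scale /= ; field.
  by apply/andP; split; lra.
have [z zxy E] : exists2 z, z \in `]x, y[ & binent y - binent x = df z * (y - x).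
  apply: MVT => // [z|].
    by rewrite in_itv /= => /andP[? ?]; apply: dh; lra.
  apply: derivable_within_continuous => z.
  by rewrite in_itv /= => /andP[? ?]; apply: ex_derive; apply: dh; lra.
move: zxy; rewrite in_itv /= => /andP[xz zy].
rewrite -subr_gt0 E mulr_gt0 ?subr_gt0 //.
by rewrite ltr_ln ?posrE; lra.
Qed.

(* The [y] in [0, 1/2] such that [ln 2 - binent y = u], for [u] in [0, ln 2]. *)
Definition binent_inv {R : realType} (u : R) : R :=
  xget 0 [set y | 0 <= y <= 2^-1 /\ ln 2 - binent y = u].

(* At [u = 0], i.e. [y = 1/2], the quotient is [0 / 0 = 0]; [2] is its limit. *)
Definition Cfun {R : realType} (u : R) : R :=
  if u == 0 then 2 else
  let y := binent_inv u in (2 - 4 * Num.sqrt (y * (1 - y))) / u.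

Lemma binent_half {R : realType} : binent (2^-1 : R) = ln 2.
Proof.
rewrite /binent; have -> : 1 - 2^-1 = 2^-1 :> R by lra.
by rewrite lnV ?posrE //; lra.
Qed.

Lemma binent_invK {R : realType} (y : R) :
  0 <= y <= 2^-1 -> binent_inv (ln 2 - binent y) = y.
Proof.
move=> y02; apply: xget_subset1 => // a b [/andP[a0 a2] ea] [/andP[b0 b2] eb].
have e : binent a = binent b by lra.
by have [ab|ba|//] := ltgtP a b; [have := binent_lt a0 ab b2|
  have := binent_lt b0 ba a2]; rewrite e ltxx.
Qed.

Lemma Cfun_binent {R : realType} (y : R) : 0 <= y < 2^-1 ->
  Cfun (ln 2 - binent y) =
  (2 - 4 * Num.sqrt (y * (1 - y))) / (ln 2 - binent y).
Proof.
move=> /andP[y0 y2]; have := binent_lt y0 y2 (lexx _); rewrite binent_half => h.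
rewrite /Cfun ifF ?binent_invK ?y0 ?ltW //.
by apply/negbTE; rewrite subr_eq0 gt_eqF.
Qed.

Definition expect {R : realType} n (f : cube n -> R) : R :=
  (2 ^+ n)^-1 * \sum_x f x.

Definition pnorm {R : realType} n (p : R) (f : cube n -> R) : R :=
  expect (fun x => `|f x| `^ p) `^ p^-1.

Definition noise {R : realType} (t : R) (f : bool -> R) (x : bool) : R :=
  f x * ((1 + expR (- t)) / 2) + f (~~ x) * ((1 - expR (- t)) / 2).

(* The [n]-th tensor power of a linear operator [A] on functions on [bool],
   through the matrix of [A] in the basis of point masses. *)
Definition tensor_power {R : realType} (A : (bool -> R) -> bool -> R) n
    (f : cube n -> R) (x : cube n) : R :=
  \sum_(y : cube n) (\prod_i A (fun b => (b == y i)%:R) (x i)) * f y.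

Definition cube_noise {R : realType} n (t : R) : (cube n -> R) -> cube n -> R :=
  @tensor_power R (noise t) n.

(* Product functions span all functions on the cube, so this identity and
   linearity characterize [cube_noise]. *)
Lemma cube_noise_prod {R : realType} n (t : R) (g : 'I_n -> bool -> R) (x : cube n) :
  cube_noise t (fun y : cube n => \prod_i g i (y i)) x = \prod_i noise t (g i) (x i).
Proof.
rewrite /cube_noise /tensor_power.
pose F i b := noise t (fun c => (c == b)%:R) (x i) * g i b.
transitivity (\sum_(y : cube n) \prod_i F i (y i)).
  by apply: eq_bigr => y _; rewrite /F big_split.
rewrite -(bigA_distr_bigA F) /F.
apply: eq_bigr => i _; rewrite big_bool /noise.
by case: (x i) => /=; ring.
Qed.

Definition rho_tilde {R : realType} (rho0 s : R) : R :=
  2 * rho0 - ln (2 / (1 + expR (- (2 * s)))).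

Definition p_exp {R : realType} (rho0 t : R) : R :=
  1 + expR (\int[lebesgue_measure]_(s in `[0, t])
              Cfun (Num.max (rho_tilde rho0 s) 0)).

(* Main.v *)
Require Import Defs.
From mathcomp Require Import all_boot all_order all_algebra.
From mathcomp Require Import all_classical all_reals all_analysis.
From mathcomp Require Import measurable_realfun.
From mathcomp Require Import ring lra.
Import Order.TTheory GRing.Theory Num.Theory.
Import numFieldNormedType.Exports.
Local Open Scope classical_set_scope.
Local Open Scope ring_scope.

Set Implicit Arguments.
Unset Strict Implicit.
Unset Printing Implicit Defensive.

(** Write [g_s] for [cube_noise s f]. Along the heat flow, with a moving exponent
    [p = p(s)], the derivative of [ln (pnorm p g_s)] is the sum of two terms: the
    growth of the exponent contributes [p' / p ^ 2] times the normalized entropy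
    of [g_s ^ p], and the flow contributes minus an energy. The Stroock-Varopoulos
    inequality [stroock_varopoulos] bounds that energy below by the energy of
    [g_s ^ (p / 2)], so the derivative is nonpositive as long as
    [p' <= c * (p - 1)], where [c] is a logarithmic Sobolev constant valid for
    [g_s ^ (p / 2)].

    The usual constant is [2]. A function of large entropy has a better one: if the
    normalized entropy of [h ^ 2] is at least [n * u], then [c] may be taken to be
    [Cfun u] ([cube_lsi]). On one coordinate, energy is a function of entropy,
    [u |-> Cfun u * u]. It is convex: with [(1 - y) / y = expR (2 * z)] its slope
    is [2 * sinh z / z], which increases with [z] ([tp_tangent]). So it lies above
    each of its tangents, and a tangent inequality is linear in entropy and mass
    ([two_point_lsi]); it can be summed over all edges of the cube, while the
    entropy is at most the sum of the mean entropies along the coordinates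
    ([entropy_subadditive]).

    The entropy of [g_s ^ p] is controlled by norms. Convexity of [ln] of the
    [p]-th moment as a function of [p] gives, for [p >= 2], a lower bound by
    [2 * ln (pnorm 2 g_s / pnorm 1 g_s)] ([tilted_entropy_ge]). The flow preserves
    the first moment of [f >= 0], and keeps at least the contribution
    [((1 + expR (- (2 * s))) / 2) ^+ n] of the diagonal of its kernel to the
    second one ([sum_cube_noise_sqr_ge]). Hence the entropy of [g_s ^ p] is at least
    [n * rho_tilde rho0 s] ([entropy_level_entropy]), and [Cfun] at that level is
    an admissible rate.

    The rate decreases in time. On a time interval the exponent is therefore moved
    with the constant rate of the right end ([pnorm_flow_le]), where the derivative
    above makes sense without any regularity of [Cfun]; refining the intervals
    yields lower Riemann sums converging to the integral in [p_exp]
    ([antitone_integral_ind]), and norms are continuous in the exponent. Only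
    positive times enter, at which [g_s] is positive and the level is below
    [ln 2]; the first, short interval uses that the flow contracts the 2-norm. *)

(** * Hyperbolic functions and monotonicity *)

Lemma derive_ge0_le {R : realType} (f df : R -> R) (a b : R) : a <= b ->
  (forall x, a <= x <= b -> is_derive x 1 f (df x)) ->
  (forall x, a < x < b -> 0 <= df x) -> f a <= f b.
Proof.
rewrite le_eqVlt => /predU1P[<-//|ab] fd df0.
have [c] : exists2 c, c \in `]a, b[ & f b - f a = df c * (b - a).
  apply: MVT => // [z|].
    by rewrite in_itv /= => /andP[? ?]; apply: fd; lra.
  apply: derivable_within_continuous => z.
  by rewrite in_itv /= => zab; apply: ex_derive; exact: fd.
rewrite in_itv /= => /df0 dfc E.
by rewrite -subr_ge0 E mulr_ge0 // subr_ge0 ltW.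
Qed.

Definition sinh {R : realType} (x : R) : R := (expR x - expR (- x)) / 2.

Definition cosh {R : realType} (x : R) : R := (expR x + expR (- x)) / 2.

Lemma is_derive_expRN {R : realType} (x : R) :
  is_derive x 1 (fun y : R => expR (- y)) (- expR (- x)).
Proof.
have H : is_derive x 1 (@expR R \o -%R) (expR (- x) * (- 1)).
  by apply: is_derive1_comp.
by apply: is_derive_eq; rewrite mulrN1.
Qed.

Lemma is_derive_sinh {R : realType} (x : R) : is_derive x 1 sinh (cosh x).
Proof.
have H := is_derive_expRN x.
by rewrite /sinh; apply: is_derive_eq; rewrite /cosh /GRing.scale /=; field.
Qed.

Lemma is_derive_cosh {R : realType} (x : R) : is_derive x 1 cosh (sinh x).
Proof.
have H := is_derive_expRN x.
by rewrite /cosh; apply: is_derive_eq; rewrite /sinh /GRing.scale /=; field.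
Qed.

Lemma cosh_gt0 {R : realType} (x : R) : 0 < cosh x.
Proof. by rewrite /cosh divr_gt0 // addr_gt0 ?expR_gt0. Qed.

Lemma cosh0 {R : realType} : cosh (0 : R) = 1.
Proof. by rewrite /cosh oppr0 expR0; lra. Qed.

Lemma sinh0 {R : realType} : sinh (0 : R) = 0.
Proof. by rewrite /sinh oppr0 expR0; lra. Qed.

Lemma cosh2_sinh2 {R : realType} (x : R) : cosh x ^+ 2 = 1 + sinh x ^+ 2.
Proof. by have := expRxMexpNx_1 x; rewrite /cosh /sinh; lra. Qed.

Lemma sinh_ge0 {R : realType} (x : R) : 0 <= x -> 0 <= sinh x.
Proof. by move=> x0; rewrite /sinh divr_ge0 // subr_ge0 ler_expR; lra. Qed.

Lemma cosh_le {R : realType} (x y : R) : 0 <= x -> x <= y -> cosh x <= cosh y.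
Proof.
move=> x0 xy; apply: (derive_ge0_le xy (fun z _ => is_derive_cosh z)) => z z1.
by apply: sinh_ge0; lra.
Qed.

(** The derivative of the difference in [y] is [x * cosh y - sinh x], and
    [sinh x <= x * cosh x]; both are instances of the monotonicity of [cosh]. *)
Lemma sinh_ratio_le {R : realType} (x y : R) : 0 <= x -> x <= y ->
  y * sinh x <= x * sinh y.
Proof.
move=> x0 xy.
have h1 : sinh x <= x * cosh x.
  suff : 0 * cosh x - sinh 0 <= x * cosh x - sinh x.
    by rewrite sinh0 mul0r subr0 subr_ge0.
  apply: (@derive_ge0_le _ (fun z => z * cosh x - sinh z)
    (fun z => cosh x - cosh z)) => // z z1.
    have H := is_derive_sinh z.
    by apply: is_derive_eq; rewrite /GRing.scale /=; ring.
  by rewrite subr_ge0 cosh_le //; lra.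
suff : x * sinh x - x * sinh x <= x * sinh y - y * sinh x by lra.
apply: (@derive_ge0_le _ (fun z => x * sinh z - z * sinh x)
    (fun z => x * cosh z - sinh x)) => // z z1.
  have H := is_derive_sinh z.
  by apply: is_derive_eq; rewrite /GRing.scale /=; ring.
have : cosh x <= cosh z by apply: cosh_le; lra.
by move=> h; have := ler_wpM2l x0 h; lra.
Qed.

(** * The two-point space in the hyperbolic parametrization *)

(** With [(1 - y) / y = expR (2 * z)], this is [ln 2 - binent y], and the next
    function is [2 - 4 * Num.sqrt (y * (1 - y))]: in the variable [z] both have
    elementary derivatives. *)
Definition tp_ent {R : realType} (z : R) : R := z * (sinh z / cosh z) - ln (cosh z).

Definition tp_dir {R : realType} (z : R) : R := 2 - 2 / cosh z.

Lemma tp_ent0 {R : realType} : tp_ent (0 : R) = 0.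
Proof. by rewrite /tp_ent cosh0 ln1 mul0r subr0. Qed.

Lemma tp_dir0 {R : realType} : tp_dir (0 : R) = 0.
Proof. by rewrite /tp_dir cosh0; lra. Qed.

Lemma is_derive_tp_ent {R : realType} (z : R) :
  is_derive z 1 tp_ent (z / cosh z ^+ 2).
Proof.
have c0 := cosh_gt0 z.
have H1 := is_derive_sinh z.
have H2 := is_derive_cosh z.
have H3 : is_derive z 1 (@ln R \o cosh) ((cosh z)^-1 * sinh z).
  by apply: is_derive1_comp; exact: is_derive1_ln.
have cn0 : cosh z != 0 by rewrite gt_eqF.
have H4 : is_derive z 1 (fun y : R => (cosh y)^-1) (- (cosh z) ^- 2 *: sinh z).
  exact: is_deriveV.
rewrite /tp_ent; apply: is_derive_eq; rewrite /GRing.scale /=.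
have -> : z / cosh z ^+ 2 = z * (cosh z ^+ 2 - sinh z ^+ 2) / cosh z ^+ 2.
  by rewrite cosh2_sinh2 addrK mulr1.
by field.
Qed.

Lemma is_derive_tp_dir {R : realType} (z : R) :
  is_derive z 1 tp_dir (2 * sinh z / cosh z ^+ 2).
Proof.
have c0 := cosh_gt0 z.
have H2 := is_derive_cosh z.
have cn0 : cosh z != 0 by rewrite gt_eqF.
have H4 : is_derive z 1 (fun y : R => (cosh y)^-1) (- (cosh z) ^- 2 *: sinh z).
  exact: is_deriveV.
rewrite /tp_dir; apply: is_derive_eq; rewrite /GRing.scale /=.
by field.
Qed.

(** The slope of the curve [z |-> (tp_ent z, tp_dir z)], with its limit at [z = 0]. *)
Definition tp_slope {R : realType} (z : R) : R :=
  if z == 0 then 2 else 2 * sinh z / z.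

(** The curve [(tp_ent, tp_dir)] is the graph of a convex function, because its
    slope [2 * sinh z / z] increases with [z]; so it lies above its tangents. *)
Lemma tp_tangent {R : realType} (z0 z : R) : 0 <= z0 -> 0 <= z ->
  tp_dir z0 + tp_slope z0 * (tp_ent z - tp_ent z0) <= tp_dir z.
Proof.
move=> z00 z1; set l := tp_slope z0.
have lo w : 0 <= w -> w <= z0 -> 2 * sinh w <= l * w.
  move=> w0 wz; rewrite /l /tp_slope; case: eqP => [z0E|/eqP z0N].
    have -> : w = 0 by lra.
    by rewrite sinh0 !mulr0.
  have zp : 0 < z0 by rewrite lt_neqAle eq_sym z0N.
  rewrite mulrAC ler_pdivlMr //.
  by have := sinh_ratio_le w0 wz; lra.
have hi w : z0 <= w -> l * w <= 2 * sinh w.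
  move=> zw; rewrite /l /tp_slope; case: eqP => [z0E|/eqP z0N].
    rewrite ler_pM2l //; suff : sinh 0 - 0 <= sinh w - w by rewrite sinh0; lra.
    apply: (@derive_ge0_le _ (fun z => sinh z - z) (fun z => cosh z - 1)).
    - by lra.
    - by move=> x _; have H := is_derive_sinh x; apply: is_derive_eq.
    by move=> x x0; rewrite subr_ge0 -cosh0 cosh_le //; lra.
  have zp : 0 < z0 by rewrite lt_neqAle eq_sym z0N.
  rewrite mulrAC ler_pdivrMr //.
  by have := sinh_ratio_le z00 zw; lra.
have dg (w : R) : is_derive w 1 (fun z => tp_dir z - l * tp_ent z)
    ((2 * sinh w - l * w) / cosh w ^+ 2).
  have H1 := is_derive_tp_ent w; have H2 := is_derive_tp_dir w.
  by apply: is_derive_eq; rewrite /GRing.scale /=; ring.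
suff : tp_dir z0 - l * tp_ent z0 <= tp_dir z - l * tp_ent z by lra.
have [zz|zz] := leP z0 z.
  apply: (derive_ge0_le zz (fun w _ => dg w)) => w w1.
  by rewrite divr_ge0 ?sqr_ge0 // subr_ge0 hi; lra.
rewrite -lerN2; apply: (@derive_ge0_le _ (fun z => - (tp_dir z - l * tp_ent z))
  (fun w => - ((2 * sinh w - l * w) / cosh w ^+ 2)) _ _ (ltW zz)).
move=> w w1; rewrite -mulNr divr_ge0 ?sqr_ge0 // oppr_ge0 subr_le0.
by apply: lo; lra.
Qed.

Lemma tp_param {R : realType} (z : R) : 0 < z ->
  let y := expR (- z) / (2 * cosh z) in
  [/\ 0 < y < 2^-1, ln 2 - binent y = tp_ent z &
      2 - 4 * Num.sqrt (y * (1 - y)) = tp_dir z].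
Proof.
move=> z0 y.
have c0 := cosh_gt0 z.
have e0 := expR_gt0 (- z); have e1 := expR_gt0 z.
have cE : 2 * cosh z = expR z + expR (- z) by rewrite /cosh; lra.
have c2 : 0 < 2 * cosh z by rewrite mulr_gt0.
have y1 : 1 - y = expR z / (2 * cosh z).
  by rewrite /y cE; field; rewrite gt_eqF // addr_gt0.
have lt : expR (- z) < expR z by rewrite ltr_expR; lra.
split.
- apply/andP; split; first by rewrite divr_gt0 // mulr_gt0.
  by rewrite /y ltr_pdivrMr //; lra.
- rewrite /binent y1 /y !ln_div ?posrE // !expRK lnM ?posrE //.
  rewrite /tp_ent.
  have -> : sinh z / cosh z = (expR z / (2 * cosh z)) - (expR (- z) / (2 * cosh z)).
    by rewrite /sinh; field; rewrite gt_eqF.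
  have : expR (- z) / (2 * cosh z) + expR z / (2 * cosh z) = 1.
    by rewrite -y1 /y; lra.
  set A := expR (- z) / _; set B := expR z / _ => AB.
  have -> : A = 1 - B by lra.
  by ring.
- rewrite y1 /y /tp_dir.
  have -> : expR (- z) / (2 * cosh z) * (expR z / (2 * cosh z)) = ((2 * cosh z)^-1) ^+ 2.
    have /eqP := expRxMexpNx_1 z; rewrite -subr_eq0 => /eqP h.
    have -> : expR (- z) / (2 * cosh z) * (expR z / (2 * cosh z)) =
       (expR z * expR (- z)) * ((2 * cosh z)^-1) ^+ 2 by ring.
    by rewrite expRxMexpNx_1 mul1r.
  rewrite sqrtr_sqr ger0_norm ?invr_ge0 ?mulr_ge0 // ?ltW //.
  by field; rewrite gt_eqF.
Qed.

Lemma tp_ent_gt0 {R : realType} (z : R) : 0 < z -> 0 < tp_ent z.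
Proof.
move=> /tp_param[/andP[y0 y1] <- _].
by rewrite subr_gt0 -binent_half; apply: binent_lt => //; exact: ltW.
Qed.

Lemma Cfun_tp {R : realType} (z : R) : 0 < z -> Cfun (tp_ent z) = tp_dir z / tp_ent z.
Proof.
move=> /tp_param[/andP[y0 y1] <- <-].
by rewrite Cfun_binent // y1 ltW.
Qed.

(** The intermediate value theorem, since [tp_ent] vanishes at [0] and is within
    [(1 + 2 * z) * expR (- (2 * z))] of [ln 2] at [z]. *)
Lemma tp_ent_onto {R : realType} (u : R) : 0 <= u < ln 2 ->
  exists2 z, 0 <= z & tp_ent z = u.
Proof.
move=> /andP[u0 u2].
pose d := ln 2 - u.
have d0 : 0 < d by rewrite subr_gt0.
pose z : R := 2 / d.
have z0 : 0 < z by rewrite divr_gt0.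
have uz : u <= tp_ent z.
  have c0 := cosh_gt0 z.
  have e0 := expR_gt0 (- z); have e1 := expR_gt0 z.
  have cE : 2 * cosh z = expR z * (1 + expR (- z) ^+ 2).
    by rewrite mulrDr mulr1 expr2 mulrA expRxMexpNx_1 mul1r /cosh; lra.
  have q0 : 0 < 1 + expR (- z) ^+ 2 by rewrite addr_gt0 ?exprn_gt0.
  have lc : ln (cosh z) <= z + expR (- z) ^+ 2 - ln 2.
    have : ln (2 * cosh z) <= z + expR (- z) ^+ 2.
      rewrite cE lnM ?posrE // expRK lerD2l; apply: le_ln1Dx.
      by have := sqr_ge0 (expR (- z)); lra.
    by rewrite lnM ?posrE //; lra.
  have th : 1 - 2 * expR (- z) ^+ 2 <= sinh z / cosh z.
    rewrite ler_pdivlMr // /sinh /cosh.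
    have := expRxMexpNx_1 z; set a := expR z; set b := expR (- z) => ab.
    have : 0 <= b ^+ 3 by rewrite exprn_ge0 // ltW.
    have -> : (1 - 2 * b ^+ 2) * ((a + b) / 2) = (a + b) / 2 - b * (a * b) - b ^+ 3 by field.
    by rewrite ab; lra.
  have : z * (1 - 2 * expR (- z) ^+ 2) <= z * (sinh z / cosh z) by rewrite ler_pM2l.
  suff : (1 + 2 * z) * expR (- z) ^+ 2 <= d by rewrite /tp_ent /d; lra.
  have : (1 + z) * expR (- z) <= 1.
    by rewrite expRN ler_pdivrMr ?mul1r ?expR_ge1Dx.
  move: e0; set b := expR (- z) => b0 zb.
  have zb2 : ((1 + z) * b) ^+ 2 <= 1.
    by rewrite expr_le1 // mulr_ge0 //; lra.
  have dz : d * z = 2 by rewrite /z; field; rewrite gt_eqF.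
  have b2 : 0 <= b ^+ 2 by exact: sqr_ge0.
  rewrite -(ler_pM2r z0) dz.
  have -> : (1 + 2 * z) * b ^+ 2 * z = 2 * ((1 + z) * b) ^+ 2 - (2 + 3 * z) * b ^+ 2 by ring.
  have : 0 <= (2 + 3 * z) * b ^+ 2 by rewrite mulr_ge0 //; lra.
  by lra.
have [] := @IVT _ (@tp_ent R) 0 z u (ltW z0).
- apply: derivable_within_continuous => w _.
  exact: (ex_derive (is_derive := is_derive_tp_ent w)).
- by rewrite tp_ent0 minElt maxElt tp_ent_gt0 // u0.
by move=> w; rewrite in_itv /= => /andP[w0 _] wu; exists w.
Qed.

(** * The function [Cfun] *)

(** Here [l] is the slope of the curve at the point of entropy [u], whose ordinate
    is [Cfun u * u], so that the last clause is the tangent inequality there. At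
    [z = 0] the tangent is below the origin, which is [Cfun u <= l]. *)
Lemma Cfun_tangent {R : realType} (u : R) : 0 <= u < ln 2 ->
  exists l : R, [/\ 2 <= Cfun u, Cfun u <= l &
    forall z, 0 <= z -> l * tp_ent z - (l - Cfun u) * u <= tp_dir z].
Proof.
move=> u02; have [z0 z00 <-] := tp_ent_onto u02.
move: z00; rewrite le_eqVlt => /predU1P[<-|z0p].
  exists 2; rewrite tp_ent0 /Cfun eqxx; split=> // z z1.
  by have := tp_tangent (lexx 0) z1; rewrite tp_ent0 tp_dir0 /tp_slope eqxx; lra.
have e0 := tp_ent_gt0 z0p.
have CE : Cfun (tp_ent z0) * tp_ent z0 = tp_dir z0.
  by rewrite Cfun_tp // divfK // gt_eqF.
exists (tp_slope z0); split.
- rewrite Cfun_tp // ler_pdivlMr //.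
  have := tp_tangent (lexx 0) (ltW z0p).
  by rewrite tp_ent0 tp_dir0 /tp_slope eqxx; lra.
- rewrite Cfun_tp // ler_pdivrMr //.
  by have := tp_tangent (ltW z0p) (lexx 0); rewrite tp_ent0 tp_dir0; lra.
- move=> z z1; have := tp_tangent (ltW z0p) z1.
  by rewrite -CE; lra.
Qed.

Lemma Cfun_le_inv {R : realType} (u : R) : 0 < u -> Cfun u <= 2 / u.
Proof.
move=> u0; rewrite /Cfun gt_eqF // ler_pM2r ?invr_gt0 //.
by rewrite lerBlDr lerDl mulr_ge0 // sqrtr_ge0.
Qed.

Lemma Cfun_ln2 {R : realType} : Cfun (ln 2 : R) = 2 / ln 2.
Proof.
have h : binent (0 : R) = 0 by rewrite /binent subr0 ln1 oppr0 mul0r mulr0 subr0.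
have z2 : 0 <= (0 : R) < 2^-1 by rewrite lexx invr_gt0 ltr0n.
have := Cfun_binent z2; rewrite h subr0 => ->.
by rewrite mul0r sqrtr0 mulr0 subr0.
Qed.

Lemma Cfun_le {R : realType} (u v : R) : 0 <= u -> u <= v -> v <= ln 2 ->
  Cfun u <= Cfun v.
Proof.
move=> u0 uv v2.
have l2 : 0 < ln 2 :> R by rewrite ln_gt0 // ltr1n.
have lt w : u <= w -> w < ln 2 -> Cfun u <= Cfun w.
  move=> uw w2.
  have u02 : 0 <= u < ln 2 by rewrite u0 (le_lt_trans uw).
  have [l [C2 Cl tan]] := Cfun_tangent u02.
  have w02 : 0 <= w < ln 2 by rewrite w2 (le_trans u0).
  have [z] := tp_ent_onto w02.
  rewrite le_eqVlt => /predU1P[<-|zp] wE.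
    by have -> : u = w by move: wE; rewrite tp_ent0; lra.
  have e0 := tp_ent_gt0 zp; rewrite -wE Cfun_tp // ler_pdivlMr //.
  have := tan z (ltW zp); rewrite wE.
  have : 0 <= (l - Cfun u) * (w - u) by rewrite mulr_ge0 // subr_ge0.
  by lra.
have [v2'|v2'] := ltP v (ln 2); first exact: lt.
have -> : v = ln 2 by apply/le_anti/andP.
have [->//|uN] := eqVneq u (ln 2).
have u2 : u < ln 2 by rewrite lt_neqAle uN (le_trans uv).
rewrite Cfun_ln2 ler_pdivlMr // leNgt; apply/negP => h.
have u02 : 0 <= u < ln 2 by rewrite u0 u2.
have [l [C2 _ _]] := Cfun_tangent u02.
have C0 : 0 < Cfun u by lra.
(* If [Cfun u] exceeded [2 / ln 2], then at [w] strictly between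
   [2 / Cfun u] and [ln 2] the bound [Cfun w <= 2 / w] would contradict
   [Cfun u <= Cfun w]. *)
pose m := Num.max u (2 / Cfun u).
have m2 : m < ln 2 by rewrite /m gt_max u2 /= ltr_pdivrMr // mulrC.
have um : u <= m by rewrite /m le_max lexx.
have Cm : 2 / Cfun u <= m by rewrite /m le_max lexx orbT.
pose w := (m + ln 2) / 2.
have mw : m < w by rewrite /w; lra.
have w2 : w < ln 2 by rewrite /w; lra.
have w0 : 0 < w by apply: le_lt_trans mw; exact: le_trans um.
have := lt w (le_trans um (ltW mw)) w2.
have := Cfun_le_inv w0; rewrite ler_pdivlMr // => h1 h2.
have : 2 < w * Cfun u by rewrite -ltr_pdivrMr //; exact: le_lt_trans mw.
by have := ler_wpM2l (ltW w0) h2; lra.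
Qed.

Definition pair_ent {R : realType} (A B : R) : R :=
  (A * ln A + B * ln B) / 2 - (A + B) / 2 * ln ((A + B) / 2).

(** Entropy and energy are homogeneous, so a pair is determined, up to the mass [m],
    by its log-ratio [z = ln (a / b)]. *)
Lemma pair_tp {R : realType} (a b : R) : 0 < b -> b <= a ->
  let m := (a ^+ 2 + b ^+ 2) / 2 in
  exists z, [/\ 0 <= z, (a - b) ^+ 2 = m * tp_dir z &
    pair_ent (a ^+ 2) (b ^+ 2) = m * tp_ent z].
Proof.
move=> b0 ba m; have a0 : 0 < a by exact: lt_le_trans ba.
pose z := ln a - ln b.
have z0 : 0 <= z by rewrite subr_ge0 ler_ln ?posrE.
have e1 : expR z = a / b by rewrite expRB !lnK.
have e2 : expR (- z) = b / a by rewrite expRN e1 invf_div.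
have an0 : a != 0 by rewrite gt_eqF.
have bn0 : b != 0 by rewrite gt_eqF.
have m0 : 0 < m by rewrite divr_gt0 // addr_gt0 ?exprn_gt0.
have ab0 : 0 < a * b by rewrite mulr_gt0.
have mn0 : a ^+ 2 + b ^+ 2 != 0 by rewrite gt_eqF // addr_gt0 ?exprn_gt0.
have cE : cosh z = m / (a * b).
  by rewrite /cosh e1 e2 /m; field; rewrite an0 bn0.
have sE : sinh z / cosh z = (a ^+ 2 - b ^+ 2) / (a ^+ 2 + b ^+ 2).
  by rewrite cE /sinh e1 e2 /m; field; rewrite mn0 an0 bn0.
exists z; split=> //.
  by rewrite /tp_dir cE /m; field; rewrite mn0 an0 bn0.
rewrite /tp_ent sE cE /pair_ent -/m ln_div ?posrE // lnM ?posrE //.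
rewrite !lnXn // /z /m !mulr2n.
by field.
Qed.

(** The one-coordinate inequality, in a form that is linear in the entropy and in
    the mass, and so can be summed over the edges of the cube. It is the tangent
    line at entropy [u]. *)
Lemma two_point_lsi {R : realType} (u : R) : 0 <= u < ln 2 ->
  exists l, [/\ 0 <= l, Cfun u <= l & forall a b : R, 0 < a -> 0 < b ->
    l * pair_ent (a ^+ 2) (b ^+ 2) - (l - Cfun u) * u * ((a ^+ 2 + b ^+ 2) / 2)
      <= (a - b) ^+ 2].
Proof.
move=> u02; have [l [C2 Cl tan]] := Cfun_tangent u02.
exists l; split=> //; first by lra.
move=> a b; wlog ba : a b / b <= a => [wl a0 b0|a0 b0].
  have [ba|/ltW ab] := leP b a; first exact: wl.
  have := wl _ _ ab b0 a0.
  rewrite /pair_ent (addrC (b ^+ 2 * _)) (addrC (b ^+ 2)).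
  by rewrite (_ : (b - a) ^+ 2 = (a - b) ^+ 2) //; ring.
have [z [z0 -> ->]] := pair_tp b0 ba.
set m := (_ + _) / 2.
have m0 : 0 <= m by rewrite divr_ge0 // addr_ge0 ?sqr_ge0.
by have := ler_wpM2l m0 (tan z z0); lra.
Qed.

(** The Stroock-Varopoulos inequality for the values [expR x] and [expR y]. With
    [z = (x - y) / 2], dividing by [expR (p * (x + y) / 2)] turns it into
    [p * sinh ((p - 2) / 2 * z) <= (p - 2) * sinh (p / 2 * z)], squared. *)
Lemma stroock_varopoulos {R : realType} (p x y : R) : 2 <= p ->
  4 * (p - 1) * (expR (p / 2 * x) - expR (p / 2 * y)) ^+ 2 <=
  p ^+ 2 * ((expR ((p - 1) * x) - expR ((p - 1) * y)) * (expR x - expR y)).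
Proof.
move=> p2; wlog yx : x y / y <= x => [wl|].
  have [yx|/ltW xy] := leP y x; first exact: wl.
  by have := wl _ _ xy; lra.
pose s := (x + y) / 2; pose z := (x - y) / 2.
have -> : x = s + z by rewrite /s /z; lra.
have -> : y = s - z by rewrite /s /z; lra.
have z0 : 0 <= z by rewrite /z; lra.
pose A := expR (p / 2 * s); pose E := expR (p / 2 * z); pose F := expR (- (p / 2 * z)).
have EF : E * F = 1 by exact: expRxMexpNx_1.
pose G := expR (((p - 2) / 2) * z); pose H := expR (- (((p - 2) / 2) * z)).
have GH : G * H = 1 by exact: expRxMexpNx_1.
have -> : expR (p / 2 * (s + z)) = A * E by rewrite /A /E -expRD; congr expR; lra.
have -> : expR (p / 2 * (s - z)) = A * F by rewrite /A /F -expRD; congr expR; lra.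
have -> : (expR ((p - 1) * (s + z)) - expR ((p - 1) * (s - z))) *
    (expR (s + z) - expR (s - z)) = A ^+ 2 * (E ^+ 2 + F ^+ 2 - G ^+ 2 - H ^+ 2).
  have h1 : expR ((p - 1) * (s + z)) * expR (s + z) = A * A * (E * E).
    by rewrite -!expRD; congr expR; lra.
  have h2 : expR ((p - 1) * (s + z)) * expR (s - z) = A * A * (G * G).
    by rewrite -!expRD; congr expR; lra.
  have h3 : expR ((p - 1) * (s - z)) * expR (s + z) = A * A * (H * H).
    by rewrite -!expRD; congr expR; lra.
  have h4 : expR ((p - 1) * (s - z)) * expR (s - z) = A * A * (F * F).
    by rewrite -!expRD; congr expR; lra.
  move: h1 h2 h3 h4; set X1 := expR ((p - 1) * (s + z)).
  set X2 := expR ((p - 1) * (s - z)); set Y1 := expR (s + z); set Y2 := expR (s - z).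
  by move=> h1 h2 h3 h4; lra.
have [zE|zN] := eqVneq z 0.
  rewrite /E /F /G /H zE !mulr0 !oppr0 expR0.
  by lra.
have zp : 0 < z by rewrite lt_neqAle eq_sym zN.
have sz0 : 0 <= (p - 2) / 2 * z by rewrite mulr_ge0 //; lra.
have h : p * (G - H) <= (p - 2) * (E - F).
  have : (p - 2) / 2 * z <= p / 2 * z by rewrite ler_pM2r //; lra.
  move=> /(sinh_ratio_le sz0); rewrite /sinh -/E -/F -/G -/H => h.
  by rewrite -(ler_pM2l zp); lra.
have h0 : 0 <= p * (G - H).
  rewrite mulr_ge0 ?subr_ge0 ?ler_expR //; first by lra.
  by rewrite ge0_cp // oppr_le0.
have h2 : (p * (G - H)) ^+ 2 <= ((p - 2) * (E - F)) ^+ 2.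
  by rewrite ler_sqr ?nnegrE // (le_trans h0).
have := ler_wpM2l (sqr_ge0 A) h2; rewrite -subr_ge0 => h3.
rewrite -subr_ge0; apply: le_trans h3 _.
rewrite [leRHS](_ : _ = A ^+ 2 * (((p - 2) * (E - F)) ^+ 2 - (p * (G - H)) ^+ 2)
   + 2 * A ^+ 2 * p ^+ 2 * (E * F - G * H)); last by ring.
by rewrite EF GH; lra.
Qed.

(** * Averages, log-moments and tilted measures *)

Section expectation.
Context {R : realType} {n : nat}.
Implicit Types (f g : cube n -> R) (x : cube n).

Lemma expect_le f g : (forall x, f x <= g x) -> expect f <= expect g.
Proof.
by move=> fg; rewrite ler_pM2l ?invr_gt0 ?exprn_gt0 //; apply: ler_sum => x _.
Qed.

Lemma expectD f g : expect (fun x => f x + g x) = expect f + expect g.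
Proof. by rewrite /expect big_split /= mulrDr. Qed.

Lemma expectZ (c : R) f : expect (fun x => c * f x) = c * expect f.
Proof. by rewrite /expect -mulr_sumr mulrCA. Qed.

Lemma expect_cst (c : R) : expect (fun _ : cube n => c) = c.
Proof.
rewrite /expect sumr_const card_ffun card_bool card_ord -[c *+ _]mulr_natr natrX.
by rewrite mulrCA mulVf ?mulr1 // expf_neq0 // pnatr_eq0.
Qed.

Lemma expect_gt0 f : (forall x, 0 < f x) -> 0 < expect f.
Proof.
move=> f0; rewrite /expect mulr_gt0 ?invr_gt0 ?exprn_gt0 //.
rewrite (bigD1 [ffun=> true]) //= ltr_wpDr //.
by apply: sumr_ge0 => x _; exact: ltW.
Qed.

Lemma eq_expect f g : f =1 g -> expect f = expect g.
Proof. by move=> fg; congr (_ * _); apply: eq_bigr. Qed.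

Implicit Types (v : cube n -> R) (a b p q : R).

Definition log_moment v a : R := ln (expect (fun x => expR (a * v x))).

Definition tilted_mean v a : R :=
  expect (fun x => expR (a * v x) * v x) / expect (fun x => expR (a * v x)).

Lemma moment_gt0 v a : 0 < expect (fun x => expR (a * v x)).
Proof. by apply: expect_gt0 => x; exact: expR_gt0. Qed.

Lemma log_moment0 v : log_moment v 0 = 0.
Proof.
rewrite /log_moment; under eq_expect => x do rewrite mul0r expR0.
by rewrite expect_cst ln1.
Qed.

(** The log-moment function is convex with derivative [tilted_mean v]: Jensen's
    inequality for the measure tilted by [expR (a * v)]. *)
Lemma log_moment_tangent v a b :
  log_moment v a + (b - a) * tilted_mean v a <= log_moment v b.
Proof.
set m := (b - a) * _; have Ma := moment_gt0 v a; have Mb := moment_gt0 v b.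
suff : expR m * expect (fun x => expR (a * v x)) <= expect (fun x => expR (b * v x)).
  rewrite -ler_ln ?posrE ?(mulr_gt0 (expR_gt0 m) Ma) //.
  by rewrite lnM ?posrE ?expR_gt0 // expRK addrC.
have h x : expR m * ((1 - m) * expR (a * v x) + (b - a) * (expR (a * v x) * v x))
    <= expR (b * v x).
  have -> : expR (b * v x) = expR m * (expR (a * v x) * expR ((b - a) * v x - m)).
    by rewrite -!expRD; congr expR; ring.
  rewrite ler_pM2l ?expR_gt0 // [leLHS](_ : _ = expR (a * v x) *
    (1 + ((b - a) * v x - m))); last by ring.
  by rewrite ler_pM2l ?expR_gt0 // expR_ge1Dx.
apply: le_trans (expect_le h).
rewrite expectZ expectD !expectZ ler_pM2l ?expR_gt0 //.
have -> : expect (fun x => expR (a * v x) * v x) =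
    tilted_mean v a * expect (fun x => expR (a * v x)).
  by rewrite /tilted_mean divfK // gt_eqF.
by rewrite mulrA -mulrDl -/m subrK mul1r.
Qed.

Lemma tilted_entropy_ge0 v p : 0 <= p * tilted_mean v p - log_moment v p.
Proof. by have := log_moment_tangent v p 0; rewrite log_moment0; lra. Qed.

(** Tangents at [2] and at [p] to the convex log-moment function: its slope at
    [p] is at least its slope between [1] and [2], and the entropy is minus the
    value at [0] of the tangent at [p]. *)
Lemma tilted_entropy_ge v p : 2 <= p ->
  log_moment v 2 - 2 * log_moment v 1 <= p * tilted_mean v p - log_moment v p.
Proof.
move=> p2.
have t21 := log_moment_tangent v 2 1.
have t2p := log_moment_tangent v 2 p.
have tp1 := log_moment_tangent v p 1.
have tp2 := log_moment_tangent v p 2.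
suff : log_moment v 2 - log_moment v 1 <= tilted_mean v p by lra.
have p1 : 0 < p - 1 by lra.
have h : (p - 2) * (log_moment v 2 - log_moment v 1) <= (p - 2) * tilted_mean v 2.
  by apply: ler_wpM2l; lra.
by rewrite -(ler_pM2l p1); lra.
Qed.

Lemma log_moment_ratio_le v q p : 0 < q -> q <= p ->
  log_moment v q / q <= log_moment v p / p.
Proof.
move=> q0 qp; have p0 : 0 < p by exact: lt_le_trans qp.
rewrite ler_pdivrMr // mulrAC ler_pdivlMr //.
have h1 := tilted_entropy_ge0 v q.
have h2 := log_moment_tangent v q p.
have : 0 <= (p - q) * (q * tilted_mean v q - log_moment v q).
  by rewrite mulr_ge0 // subr_ge0.
by have := ler_wpM2l (ltW q0) h2; lra.
Qed.

End expectation.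

(** * Subadditivity of entropy and the logarithmic Sobolev inequality *)

Definition flip {n} (i : 'I_n) (x : cube n) : cube n :=
  [ffun j => if j == i then ~~ x j else x j].

Lemma flipK {n} (i : 'I_n) : involutive (flip i).
Proof. by move=> x; apply/ffunP => j; rewrite !ffunE; case: eqP; rewrite ?negbK. Qed.

Lemma sum_flip {R : realType} {n} (i : 'I_n) (f : cube n -> R) :
  \sum_x f (flip i x) = \sum_x f x.
Proof. by rewrite [RHS](reindex_inj (inv_inj (flipK i))). Qed.

(** Takes its first [k] coordinates from [y] and the others from [x], so that the
    average over [y] is the conditional expectation given the coordinates from
    [k] on. *)
Definition mix {n} (k : nat) (y x : cube n) : cube n :=
  [ffun j : 'I_n => if (j < k)%N then y j else x j].

Definition tail_mean {R : realType} {n} (F : cube n -> R) (k : nat) (x : cube n) : R :=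
  expect (fun y => F (mix k y x)).

Section subadditivity.
Context {R : realType} {n : nat}.
Implicit Types (F h : cube n -> R) (x : cube n).

Lemma tail_mean0 F x : tail_mean F 0 x = F x.
Proof.
rewrite /tail_mean -[RHS](expect_cst (n := n)); apply: eq_expect => y.
by congr F; apply/ffunP => j; rewrite ffunE.
Qed.

Lemma tail_mean_full F x : tail_mean F n x = expect F.
Proof.
rewrite /tail_mean; apply: eq_expect => y.
by congr F; apply/ffunP => j; rewrite ffunE ltn_ord.
Qed.

(** For each [y], the points [mix i.+1 y x] and [mix i.+1 (flip i y) x] are
    [mix i y x] and [mix i y (flip i x)], in one order or the other. *)
Lemma tail_meanS F (i : 'I_n) x :
  tail_mean F i.+1 x = (tail_mean F i x + tail_mean F i (flip i x)) / 2.
Proof.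
suff : 2 * \sum_y F (mix i.+1 y x) =
    \sum_y F (mix i y x) + \sum_y F (mix i y (flip i x)).
  by rewrite /tail_mean /expect -mulrDr => <-; field; rewrite expf_neq0.
rewrite mulr_natl mulr2n -{2}(sum_flip i) -!big_split /=.
apply: eq_bigr => y _.
have [yx|yx] := eqVneq (y i) (x i); last rewrite addrC.
  congr (F _ + F _); apply/ffunP => j; rewrite !ffunE ltnS leq_eqVlt;
  case: (eqVneq j i) => [->|ji]; rewrite ?eqxx ?ltnn ?yx //=;
  by have /negbTE -> : nat_of_ord j != i by [].
congr (F _ + F _); apply/ffunP => j; rewrite !ffunE ltnS leq_eqVlt;
  case: (eqVneq j i) => [->|ji]; rewrite ?eqxx ?ltnn //=;
  try by have /negbTE -> : nat_of_ord j != i by [].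
  by case: (y i) (x i) yx => [] [].
by case: (y i) (x i) yx => [] [].
Qed.

Lemma tail_mean_gt0 F k x : (forall x, 0 < F x) -> 0 < tail_mean F k x.
Proof. by move=> F0; apply: expect_gt0. Qed.

Lemma gibbs_term (X c M m : R) : 0 < X -> 0 < c -> 0 < M -> 0 < m ->
  X * ln (c / m) <= X * ln X - X * ln M + (c * M / m - X).
Proof.
move=> X0 c0 M0 m0; have cM0 := mulr_gt0 c0 M0; have Xm0 := mulr_gt0 X0 m0.
have q0 := divr_gt0 cM0 Xm0.
have : X * ln (c * M / (X * m)) <= c * M / m - X.
  have -> : c * M / m - X = X * (c * M / (X * m) - 1).
    by field; rewrite !gt_eqF.
  rewrite ler_pM2l // -[in leLHS](subrK 1 (_ / _)) addrC.
  by apply: le_ln1Dx; lra.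
rewrite !ln_div ?posrE // !lnM ?posrE //.
by lra.
Qed.

(** The variational formula for the entropy of a pair, against the test function
    [ln] of the density [(a / m, b / m)]. *)
Lemma pair_gibbs (A B a b : R) : 0 < A -> 0 < B -> 0 < a -> 0 < b ->
  let m := (a + b) / 2 in
  (A * ln (a / m) + B * ln (b / m)) / 2 <= pair_ent A B.
Proof.
move=> A0 B0 a0 b0 /=; set m := (a + b) / 2; rewrite /pair_ent; set M := (A + B) / 2.
have m0 : 0 < m by rewrite divr_gt0 // addr_gt0.
have M0 : 0 < M by rewrite divr_gt0 // addr_gt0.
have key X c X0 c0 := @gibbs_term X c M m X0 c0 M0 m0.
have h1 := key _ _ A0 a0; have h2 := key _ _ B0 b0.
have E : a * M / m + b * M / m = A + B.
  by rewrite -mulrDl -mulrDl /M /m; field; rewrite gt_eqF // addr_gt0.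
have EM (c : R) : M * c = (A * c + B * c) / 2 by rewrite /M; field.
by rewrite EM; lra.
Qed.

(** When [ln (F / expect F)] is telescoped along the conditional means of [F], the
    [i]-th increment is an admissible test function in the variational formula for
    the entropy along coordinate [i]. *)
Lemma entropy_subadditive F : (forall x, 0 < F x) ->
  \sum_x F x * ln (F x / expect F) <=
  \sum_(i < n) \sum_x pair_ent (F x) (F (flip i x)).
Proof.
move=> F0.
have tm0 k x : 0 < tail_mean F k x by exact: tail_mean_gt0.
pose D (k : nat) x := ln (tail_mean F k x / tail_mean F k.+1 x).
have -> : \sum_x F x * ln (F x / expect F) = \sum_(i < n) \sum_x F x * D i x.
  rewrite exchange_big; apply: eq_bigr => x _; rewrite -mulr_sumr; congr (_ * _).
  have := @telescope_sumr R 0 n (fun k => - ln (tail_mean F k x)) (leq0n n).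
  rewrite tail_mean0 tail_mean_full opprK addrC -ln_div ?posrE ?expect_gt0 // => <-.
  rewrite big_mkord; apply: eq_bigr => i _.
  by rewrite /D ln_div ?posrE // opprK addrC.
apply: ler_sum => i _.
have -> : \sum_x F x * D i x =
    \sum_x (F x * D i x + F (flip i x) * D i (flip i x)) / 2.
  rewrite -mulr_suml big_split /= (sum_flip i (fun x => F x * D i x)).
  by field.
apply: ler_sum => x _; rewrite /D !tail_meanS flipK.
by rewrite [tail_mean F i (flip i x) + _]addrC; exact: pair_gibbs.
Qed.

(** The tangent form of the one-coordinate inequality is linear in entropy and
    mass, so it sums to the cube; at entropy at least [n * u] per unit of mass the
    tangent at [u] is above the line of slope [Cfun u] through the origin. *)
Lemma cube_lsi h (u : R) : 0 <= u < ln 2 -> (forall x, 0 < h x) ->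
  let F x := h x ^+ 2 in
  let ent := \sum_x F x * ln (F x / expect F) in
  n%:R * u * \sum_x F x <= ent ->
  Cfun u * ent <= \sum_(i < n) \sum_x (h x - h (flip i x)) ^+ 2.
Proof.
move=> u02 h0 F ent hent.
have F0 x : 0 < F x by rewrite exprn_gt0.
have [l [l0 Cl loc]] := two_point_lsi u02.
have sub := entropy_subadditive F0.
have : l * (\sum_(i < n) \sum_x pair_ent (F x) (F (flip i x)))
    - (l - Cfun u) * u * (n%:R * \sum_x F x)
    <= \sum_(i < n) \sum_x (h x - h (flip i x)) ^+ 2.
  have -> : n%:R * (\sum_x F x) = \sum_(i < n) \sum_x (F x + F (flip i x)) / 2.
    rewrite [RHS](eq_bigr (fun=> \sum_x F x)) => [|i _].
      by rewrite sumr_const card_ord mulr_natl.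
    by rewrite -mulr_suml big_split /= sum_flip; field.
  rewrite !mulr_sumr -sumrB; apply: ler_sum => i _.
  by rewrite !mulr_sumr -sumrB; apply: ler_sum => x _; exact: loc.
have := ler_wpM2l l0 sub; rewrite -/ent.
have : 0 <= (l - Cfun u) * (ent - n%:R * u * \sum_x F x).
  by rewrite mulr_ge0 // subr_ge0.
by lra.
Qed.

End subadditivity.

(** * The heat kernel of the cube *)

Lemma is_derive_prod {R : realType} {I : eqType} (r : seq I) (f : I -> R -> R)
    (df : I -> R) (t : R) :
  uniq r -> (forall i, is_derive t 1 (f i) (df i)) ->
  is_derive t 1 (fun s => \prod_(i <- r) f i s)
    (\sum_(i <- r) df i * \prod_(j <- r | j != i) f j t).
Proof.
move=> + fd; elim: r => [_|a r IH /= /andP[ar /IH {}IH]].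
  under eq_fun do rewrite big_nil.
  by rewrite big_nil; exact: is_derive_cst.
under eq_fun do rewrite big_cons.
have H := fd a; apply: is_derive_eq; rewrite /GRing.scale /=.
rewrite !big_cons eqxx /= addrC; congr (_ + _).
  rewrite mulrC; congr (_ * _); rewrite big_seq [RHS]big_seq_cond.
  apply: eq_bigl => j; case: (boolP (j \in r)) => //= jr.
  by apply/esym; apply: contra ar => /eqP <-.
rewrite mulr_sumr [LHS]big_seq [RHS]big_seq; apply: eq_bigr => i ir.
rewrite big_cons ifT 1?mulrCA //.
by apply: contra ar => /eqP ->.
Qed.

Definition bit_kernel {R : realType} (t : R) (b c : bool) : R :=
  noise t (fun a => (a == c)%:R) b.

Definition cube_kernel {R : realType} {n} (t : R) (x y : cube n) : R :=
  \prod_i bit_kernel t (x i) (y i).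

Section bit_kernel.
Context {R : realType}.
Implicit Types (t : R) (b c : bool).

Lemma bit_kernelE t b c :
  bit_kernel t b c = if b == c then (1 + expR (- t)) / 2 else (1 - expR (- t)) / 2.
Proof.
by rewrite /bit_kernel /noise; case: b c => [] [] /=;
  rewrite ?mul1r ?mul0r ?addr0 ?add0r.
Qed.

Lemma bit_kernel_ge0 t b c : 0 <= t -> 0 <= bit_kernel t b c.
Proof.
move=> t0; have e0 := expR_gt0 (- t).
have e1 : expR (- t) <= 1 by rewrite expR_le1 oppr_le0.
by rewrite bit_kernelE; case: ifP => _; rewrite divr_ge0 //; lra.
Qed.

Lemma bit_kernel_gt0 t b c : 0 < t -> 0 < bit_kernel t b c.
Proof.
move=> t0; have e0 := expR_gt0 (- t).
have e1 : expR (- t) < 1 by rewrite expR_lt1 oppr_lt0.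
by rewrite bit_kernelE; case: ifP => _; rewrite divr_gt0 //; lra.
Qed.

Lemma sum_bit_kernel t b : \sum_c bit_kernel t b c = 1.
Proof. by rewrite big_bool !bit_kernelE; case: b => /=; field. Qed.

Lemma bit_kernelC t b c : bit_kernel t b c = bit_kernel t c b.
Proof. by rewrite !bit_kernelE eq_sym. Qed.

Lemma sum_bit_kernel_sqr t c :
  \sum_b bit_kernel t b c ^+ 2 = (1 + expR (- (2 * t))) / 2.
Proof.
have -> : expR (- (2 * t)) = expR (- t) ^+ 2.
  by rewrite expr2 -expRD; congr expR; ring.
by rewrite big_bool !bit_kernelE; case: c => /=; field.
Qed.

Lemma is_derive_bit_kernel t b c :
  is_derive t 1 (fun s => bit_kernel s b c)
    ((bit_kernel t (~~ b) c - bit_kernel t b c) / 2).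
Proof.
have H := is_derive_expRN t.
have -> : (fun s : R => bit_kernel s b c) =
    (fun s : R => if b == c then (1 + expR (- s)) / 2 else (1 - expR (- s)) / 2).
  by apply/funext => s; rewrite bit_kernelE.
rewrite !bit_kernelE; case: b c => [] [] /=; apply: is_derive_eq;
  by rewrite /GRing.scale /=; field.
Qed.

End bit_kernel.

Section cube_kernel.
Context {R : realType} {n : nat}.
Implicit Types (t : R) (f : cube n -> R) (x y z : cube n).

Lemma cube_noiseE t f x : cube_noise t f x = \sum_y cube_kernel t x y * f y.
Proof. by []. Qed.

Lemma cube_kernel_ge0 t x y : 0 <= t -> 0 <= cube_kernel t x y.
Proof. by move=> t0; apply: prodr_ge0 => i _; exact: bit_kernel_ge0. Qed.

Lemma cube_kernel_gt0 t x y : 0 < t -> 0 < cube_kernel t x y.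
Proof. by move=> t0; apply: prodr_gt0 => i _; exact: bit_kernel_gt0. Qed.

Lemma cube_kernelC t x y : cube_kernel t x y = cube_kernel t y x.
Proof. by apply: eq_bigr => i _; rewrite bit_kernelC. Qed.

Lemma sum_cube_kernel t x : \sum_y cube_kernel t x y = 1.
Proof.
rewrite -(bigA_distr_bigA (fun i c => bit_kernel t (x i) c)).
by rewrite big1 // => i _; exact: sum_bit_kernel.
Qed.

Lemma sum_cube_kernel_sqr t y :
  \sum_x cube_kernel t x y ^+ 2 = ((1 + expR (- (2 * t))) / 2) ^+ n.
Proof.
transitivity (\sum_(x : cube n) \prod_i (bit_kernel t (x i) (y i) ^+ 2)).
  by apply: eq_bigr => x _; rewrite prodrXl.
rewrite -(bigA_distr_bigA (fun i b => bit_kernel t b (y i) ^+ 2)).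
under eq_bigr do rewrite sum_bit_kernel_sqr.
by rewrite prodr_const card_ord.
Qed.

Lemma sum_cube_noise t f : \sum_x cube_noise t f x = \sum_x f x.
Proof.
under eq_bigr do rewrite cube_noiseE.
rewrite exchange_big; apply: eq_bigr => y _; rewrite -mulr_suml.
by under eq_bigr do rewrite cube_kernelC; rewrite sum_cube_kernel mul1r.
Qed.

Lemma cube_noise_gt0 t f x : 0 < t -> (forall y, 0 <= f y) -> (exists y, f y != 0) ->
  0 < cube_noise t f x.
Proof.
move=> t0 f0 [y fy]; rewrite cube_noiseE (bigD1 y) //= ltr_wpDr //.
  by apply: sumr_ge0 => z _; rewrite mulr_ge0 // cube_kernel_ge0 // ltW.
by rewrite mulr_gt0 ?cube_kernel_gt0 // lt_neqAle eq_sym fy f0.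
Qed.

(** Jensen's inequality for the rows of the kernel, which is doubly stochastic. *)
Lemma sum_cube_noise_sqr_le t f : 0 <= t ->
  \sum_x cube_noise t f x ^+ 2 <= \sum_x f x ^+ 2.
Proof.
move=> t0; rewrite -[leRHS](sum_cube_noise t); apply: ler_sum => x _.
have E (m : R) : \sum_y cube_kernel t x y * (f y - m) ^+ 2 =
    cube_noise t (fun y => f y ^+ 2) x - 2 * m * cube_noise t f x
    + m ^+ 2 * \sum_y cube_kernel t x y.
  rewrite !cube_noiseE !mulr_sumr -sumrB -big_split; apply: eq_bigr => y _ /=.
  by ring.
set m := cube_noise t f x.
have : 0 <= \sum_y cube_kernel t x y * (f y - m) ^+ 2.
  by apply: sumr_ge0 => y _; rewrite mulr_ge0 ?sqr_ge0 // cube_kernel_ge0.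
by rewrite E sum_cube_kernel -/m; lra.
Qed.

(** For a nonnegative function, dropping the cross terms of the square leaves the
    diagonal of the kernel at time [2 * t]. *)
Lemma sum_cube_noise_sqr_ge t f : 0 <= t -> (forall x, 0 <= f x) ->
  ((1 + expR (- (2 * t))) / 2) ^+ n * \sum_x f x ^+ 2
    <= \sum_x cube_noise t f x ^+ 2.
Proof.
move=> t0 f0.
have -> : ((1 + expR (- (2 * t))) / 2) ^+ n * \sum_x f x ^+ 2 =
    \sum_x \sum_y (cube_kernel t x y * f y) ^+ 2.
  rewrite exchange_big mulr_sumr; apply: eq_bigr => y _.
  by rewrite -(sum_cube_kernel_sqr t y) mulr_suml; apply: eq_bigr => x _; rewrite exprMn.
apply: ler_sum => x _; rewrite cube_noiseE.
have h0 y : 0 <= cube_kernel t x y * f y by rewrite mulr_ge0 // cube_kernel_ge0.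
rewrite [leRHS]expr2 mulr_suml; apply: ler_sum => y _.
rewrite expr2 ler_wpM2l // (bigD1 y) //= lerDl.
by apply: sumr_ge0.
Qed.

Definition laplacian f x : R := \sum_i (f (flip i x) - f x) / 2.

Lemma cube_kernel_flip t (i : 'I_n) x y :
  cube_kernel t (flip i x) y =
  bit_kernel t (~~ x i) (y i) * \prod_(j | j != i) bit_kernel t (x j) (y j).
Proof.
rewrite /cube_kernel (bigD1 i) //= ffunE eqxx; congr (_ * _).
by apply: eq_bigr => j /negbTE ji; rewrite ffunE ji.
Qed.

Lemma is_derive_cube_noise t f x :
  is_derive t 1 (fun s => cube_noise s f x) (laplacian (cube_noise t f) x).
Proof.
have dK y : is_derive t 1 (fun s => cube_kernel s x y)
    (\sum_i (cube_kernel t (flip i x) y - cube_kernel t x y) / 2).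
  rewrite [X in is_derive _ _ _ X](_ : _ = \sum_(i <- index_enum 'I_n)
      ((bit_kernel t (~~ x i) (y i) - bit_kernel t (x i) (y i)) / 2) *
      \prod_(j <- index_enum 'I_n | j != i) bit_kernel t (x j) (y j)); last first.
    apply: eq_bigr => i _; rewrite cube_kernel_flip [cube_kernel t x y](bigD1 i) //=.
    by rewrite -mulrBl mulrAC.
  apply: is_derive_prod; first exact: index_enum_uniq.
  by move=> i; exact: is_derive_bit_kernel.
have : is_derive t 1 (\sum_y (fun s => cube_kernel s x y * f y))
    (\sum_y (\sum_i (cube_kernel t (flip i x) y - cube_kernel t x y) / 2) * f y).
  elim/big_ind2 : _ => [|u a v b|y _]; first exact: is_derive_cst.
    exact: is_deriveD.
  by have H := dK y; apply: is_derive_eq; rewrite /GRing.scale /=; ring.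
have -> : (\sum_y (fun s => cube_kernel s x y * f y)) = (fun s => cube_noise s f x).
  by apply/funext => s; rewrite fct_sumE cube_noiseE.
move=> H; apply: is_derive_eq; rewrite /laplacian.
under eq_bigr do rewrite mulr_suml.
rewrite exchange_big; apply: eq_bigr => i _.
rewrite !cube_noiseE -sumrB mulr_suml; apply: eq_bigr => y _.
by rewrite -mulrBl mulrAC.
Qed.

End cube_kernel.

(** * Decay of norms along the heat flow *)

Section decay.
Context {R : realType} {n : nat}.
Implicit Types (f g v : cube n -> R) (x : cube n) (p q s t u : R).

Lemma sum_expect f : \sum_x f x = 2 ^+ n * expect f.
Proof. by rewrite /expect mulrA mulfV ?mul1r // expf_neq0 // pnatr_eq0. Qed.

Lemma pnorm_log_moment q g : 0 < q -> (forall x, 0 < g x) ->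
  pnorm q g = expR (log_moment (fun x => ln (g x)) q / q).
Proof.
move=> q0 g0; rewrite /pnorm.
under eq_expect => x do rewrite gtr0_norm // /powR gt_eqF //.
by rewrite /powR gt_eqF ?moment_gt0 // mulrC.
Qed.

Lemma dirichlet_form (phi g : cube n -> R) :
  \sum_x phi x * laplacian g x =
  - 4^-1 * \sum_(i < n) \sum_x (phi x - phi (flip i x)) * (g x - g (flip i x)).
Proof.
rewrite /laplacian; under eq_bigr do rewrite mulr_sumr.
rewrite exchange_big mulr_sumr; apply: eq_bigr => i _ /=.
have E : \sum_x phi x * ((g (flip i x) - g x) / 2) =
    \sum_x phi (flip i x) * ((g x - g (flip i x)) / 2).
  rewrite -(sum_flip i (fun x => phi x * ((g (flip i x) - g x) / 2))).
  by apply: eq_bigr => x _; rewrite flipK.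
have -> : \sum_x phi x * ((g (flip i x) - g x) / 2) =
    2^-1 * (\sum_x phi x * ((g (flip i x) - g x) / 2) +
    \sum_x phi (flip i x) * ((g x - g (flip i x)) / 2)).
  by rewrite -E; field.
rewrite -big_split /= !mulr_sumr; apply: eq_bigr => x _.
by field.
Qed.

(** The Stroock-Varopoulos inequality reduces the energy of [exp (p * v)] to that
    of its square root [exp (p / 2 * v)], to which the logarithmic Sobolev
    inequality applies. *)
Lemma laplacian_log_sobolev v p u : 2 <= p -> 0 <= u < ln 2 ->
  let M := expect (fun x => expR (p * v x)) in
  let ent := p * tilted_mean v p - log_moment v p in
  n%:R * u <= ent ->
  (p - 1) * Cfun u * (M * ent) +
  p ^+ 2 * expect (fun x => expR ((p - 1) * v x) * laplacian (fun y => expR (v y)) x)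
    <= 0.
Proof.
move=> p2 u02 M ent hent.
have M0 : 0 < M by exact: moment_gt0.
have N0 : 0 < 2 ^+ n :> R by rewrite exprn_gt0.
pose h x := expR (p / 2 * v x).
have h0 x : 0 < h x by exact: expR_gt0.
have hE x : h x ^+ 2 = expR (p * v x).
  by rewrite expr2 -expRD; congr expR; field.
have EhE : expect (fun x => h x ^+ 2) = M by apply: eq_expect.
have entE : \sum_x h x ^+ 2 * ln (h x ^+ 2 / expect (fun x => h x ^+ 2)) =
    2 ^+ n * (M * ent).
  rewrite EhE.
  transitivity (\sum_x (p * (expR (p * v x) * v x) - ln M * expR (p * v x))).
    apply: eq_bigr => x _; rewrite hE ln_div ?posrE ?expR_gt0 // expRK.
    by ring.
  rewrite sumrB -!mulr_sumr !sum_expect -/M /ent /tilted_mean /log_moment -/M.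
  by field; rewrite gt_eqF.
have lsi := cube_lsi u02 h0.
rewrite /= entE sum_expect EhE in lsi.
have {}lsi : Cfun u * (2 ^+ n * (M * ent)) <=
    \sum_(i < n) \sum_x (h x - h (flip i x)) ^+ 2.
  apply: lsi; have -> : n%:R * u * (2 ^+ n * M) = 2 ^+ n * (M * (n%:R * u)) by ring.
  by rewrite !ler_pM2l.
have sv : 4 * (p - 1) * \sum_(i < n) \sum_x (h x - h (flip i x)) ^+ 2 <=
    p ^+ 2 * \sum_(i < n) \sum_x (expR ((p - 1) * v x) - expR ((p - 1) * v (flip i x)))
      * (expR (v x) - expR (v (flip i x))).
  rewrite !mulr_sumr; apply: ler_sum => i _; rewrite !mulr_sumr.
  by apply: ler_sum => x _; exact: stroock_varopoulos.
have := dirichlet_form (fun x => expR ((p - 1) * v x)) (fun y => expR (v y)).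
rewrite sum_expect /=; set D := expect _; set S := \sum_(i < n) _ => DS.
rewrite -(ler_pM2l N0) mulr0.
have p1 : 0 <= 4 * (p - 1) by lra.
have := ler_wpM2l p1 lsi.
have : p ^+ 2 * (2 ^+ n * D) = - 4^-1 * (p ^+ 2 * S) by rewrite DS; ring.
rewrite -/S in sv.
by lra.
Qed.

Lemma is_derive_log_moment (v : R -> cube n -> R) (dv : cube n -> R) (p : R -> R) dp s :
  (forall x, is_derive s 1 (v ^~ x) (dv x)) -> is_derive s 1 p dp ->
  is_derive s 1 (fun t => log_moment (v t) (p t))
    (dp * tilted_mean (v s) (p s) + p s *
     (expect (fun x => expR (p s * v s x) * dv x) / expect (fun x => expR (p s * v s x)))).
Proof.
move=> dvx dpx; set M := expect (fun x => expR (p s * v s x)).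
have M0 : 0 < M by exact: moment_gt0.
have de x : is_derive s 1 (fun t => expR (p t * v t x))
    (expR (p s * v s x) * (dp * v s x + p s * dv x)).
  have H := dvx x.
  have H1 : is_derive s 1 (fun t => p t * v t x) (dp * v s x + p s * dv x).
    by apply: is_derive_eq; rewrite /GRing.scale /=; ring.
  exact: is_derive1_comp.
have dS : is_derive s 1 (\sum_x (fun t => expR (p t * v t x)))
    (\sum_x expR (p s * v s x) * (dp * v s x + p s * dv x)).
  elim/big_ind2 : _ => [|? ? ? ?|x _]; first exact: is_derive_cst.
    exact: is_deriveD.
  exact: de.
have dM : is_derive s 1 (fun t => expect (fun x => expR (p t * v t x)))
    (dp * expect (fun x => expR (p s * v s x) * v s x) +
     p s * expect (fun x => expR (p s * v s x) * dv x)).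
  rewrite (_ : (fun t => _) = (fun t => (2 ^+ n)^-1 *
      (\sum_x (fun t => expR (p t * v t x))) t)); last first.
    by apply/funext => t; rewrite fct_sumE.
  apply: is_derive_eq; rewrite /GRing.scale /= -!expectZ -expectD.
  by rewrite /expect; congr (_ * _); apply: eq_bigr => x _; ring.
have dl : is_derive (expect (fun x => expR (p s * v s x))) 1 (@ln R) M^-1.
  exact: is_derive1_ln.
have H : is_derive s 1 (@ln R \o (fun t => expect (fun x => expR (p t * v t x))))
    (M^-1 * (dp * expect (fun x => expR (p s * v s x) * v s x) +
     p s * expect (fun x => expR (p s * v s x) * dv x))).
  by apply: is_derive1_comp.
apply: is_derive_eq; rewrite /tilted_mean -/M.
by field; rewrite gt_eqF.
Qed.

(** The exponent solves [dp / dt = c * (p - 1)], for which the growth of the norm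
    caused by the exponent is compensated by the dissipation of energy, as long as
    the entropy allows a log-Sobolev constant [c]. *)
Lemma pnorm_flow_le f u q s0 s1 : (forall x, 0 <= f x) -> (exists x, f x != 0) ->
  0 < s0 -> s0 <= s1 -> 2 <= q -> 0 <= u < ln 2 ->
  (forall s p, s0 <= s <= s1 -> 2 <= p ->
    let v x := ln (cube_noise s f x) in
    n%:R * u <= p * tilted_mean v p - log_moment v p) ->
  pnorm (1 + (q - 1) * expR (Cfun u * (s1 - s0))) (cube_noise s1 f)
    <= pnorm q (cube_noise s0 f).
Proof.
move=> f0 fN s00 s01 q2 u02 hent.
have C0 : 0 <= Cfun u by have [l [C2 _ _]] := Cfun_tangent u02; lra.
pose p s := 1 + (q - 1) * expR (Cfun u * (s - s0)).
pose dp s := Cfun u * (p s - 1).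
have p2 s : s0 <= s -> 2 <= p s.
  move=> s0s; have : 1 <= expR (Cfun u * (s - s0)).
    by rewrite -expR0 ler_expR mulr_ge0 // subr_ge0.
  have q1 : 0 <= q - 1 by lra.
  by move=> /(ler_wpM2l q1); rewrite /p; lra.
have dpP s : is_derive s 1 p (dp s).
  have H : is_derive s 1 (fun s => expR (Cfun u * (s - s0)))
      (expR (Cfun u * (s - s0)) * Cfun u).
    apply: is_derive1_comp; apply: is_derive_eq.
    by rewrite /GRing.scale /=; ring.
  rewrite /p; apply: is_derive_eq; rewrite /dp /p /GRing.scale /=; ring.
pose v s x := ln (cube_noise s f x).
pose dv s x := laplacian (cube_noise s f) x / cube_noise s f x.
have g0 s x : s0 <= s -> 0 < cube_noise s f x.
  by move=> s0s; apply: cube_noise_gt0 => //; exact: lt_le_trans s0s.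
have dvP s x : s0 <= s -> is_derive s 1 (v ^~ x) (dv s x).
  move=> s0s; have H := is_derive_cube_noise s f x.
  have H2 : is_derive (cube_noise s f x) 1 (@ln R) (cube_noise s f x)^-1.
    by apply: is_derive1_ln; exact: g0.
  by have := is_derive1_comp H2 H; rewrite mulrC.
pose M s := expect (fun x => expR (p s * v s x)).
pose D s := expect (fun x => expR (p s * v s x) * dv s x).
pose A s := p s * tilted_mean (v s) (p s) - log_moment (v s) (p s).
pose dphi s := (dp s * A s + p s ^+ 2 * (D s / M s)) / p s ^+ 2.
have phiP s : s0 <= s ->
    is_derive s 1 (fun s => log_moment (v s) (p s) / p s) (dphi s).
  move=> s0s; have pN : p s != 0 by rewrite gt_eqF //; have := p2 s s0s; lra.
  have H1 := is_derive_log_moment (fun x => dvP s x s0s) (dpP s).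
  have H2 := dpP s.
  have H3 : is_derive s 1 (fun y => (p y)^-1) (- (p s) ^- 2 *: dp s).
    exact: is_deriveV.
  apply: is_derive_eq; rewrite /dphi /A /D /M /GRing.scale /=.
  have MN : expect (fun x => expR (p s * v s x)) != 0 by rewrite gt_eqF // moment_gt0.
  by field; rewrite MN pN.
have dphi_le0 s : s0 <= s <= s1 -> dphi s <= 0.
  move=> /andP[s0s ss1].
  have ps2 := p2 s s0s; have pp : 0 < p s ^+ 2 by rewrite exprn_gt0 //; lra.
  have M0 : 0 < M s by exact: moment_gt0.
  rewrite /dphi pmulr_lle0 ?invr_gt0 //.
  rewrite -(pmulr_rle0 _ M0).
  have := laplacian_log_sobolev ps2 u02 (hent s (p s) _ ps2).
  rewrite s0s ss1 => /(_ isT); rewrite -/(v s) -/(M s) -/(A s).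
  apply: le_trans.
  have -> : M s * (dp s * A s + p s ^+ 2 * (D s / M s)) =
      (p s - 1) * Cfun u * (M s * A s) + p s ^+ 2 * D s.
    by rewrite /dp; field; rewrite gt_eqF.
  rewrite lerD2l ler_pM2l // /D le_eqVlt; apply/orP; left; apply/eqP.
  apply: eq_expect => x; rewrite /dv.
  have gE y : expR (v s y) = cube_noise s f y by rewrite lnK // posrE; exact: g0.
  have -> : laplacian (fun y => expR (v s y)) x = laplacian (cube_noise s f) x.
    by rewrite /laplacian; apply: eq_bigr => i _; rewrite !gE.
  rewrite mulrBl mul1r expRB gE.
  by rewrite mulrA mulrAC.
have q0 : 0 < q by lra.
have pE : p s0 = q by rewrite /p subrr mulr0 expR0; ring.
have p10 : 0 < p s1 by have := p2 s1 s01; lra.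
rewrite -/(p s1) !pnorm_log_moment // => [|x|x]; try by apply: g0.
rewrite ler_expR -lerN2 -pE -/(v s0) -/(v s1).
apply: (@derive_ge0_le _ (fun s => - (log_moment (v s) (p s) / p s))
  (fun s => - dphi s)) => // s ss.
- by apply: is_deriveN; apply: phiP; case/andP: ss.
- by rewrite oppr_ge0 dphi_le0 //; case/andP: ss => /ltW -> /ltW ->.
Qed.

End decay.

(** * Integrating a decreasing rate *)

Section antitone_integral.
Context {R : realType}.
Variable F : R -> R.
Hypotheses (F_anti : nonincreasing_fun F) (F_ge0 : forall s, 0 <= F s).
Local Notation mu := (@lebesgue_measure R).
Local Notation I t := (\int[mu]_(s in `[0, t]) F s).

Lemma antitone_integrable (i : interval R) (a b : R) : [set` i] `<=` `[a, b] ->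
  mu.-integrable [set` i] (EFin \o F).
Proof.
move=> iab; apply: (@integrableS _ _ _ mu `[a, b]%classic) => //.
apply: measurable_bounded_integrable => //.
- by rewrite /= lebesgue_measure_itv; case: ifP => _; rewrite ?ltry // -EFinB ltry.
- exact: nonincreasing_measurable.
exists (F a); split; first exact: num_real.
move=> y Fy x /=; rewrite in_itv /= => /andP[ax _].
by rewrite ger0_norm //; apply: ltW; apply: le_lt_trans Fy; exact: F_anti.
Qed.

Lemma antitone_integral_le (a b : R) : 0 <= a -> a <= b ->
  I b <= I a + (b - a) * F a.
Proof.
move=> a0 ab; rewrite -lerBlDl.
rewrite (@Rintegral_itvB _ F (BLeft 0) (BRight b) a) //; last first.
  exact: (@antitone_integrable _ 0 b).
apply: le_trans (_ : \int[mu]_(s in `]a, b]) F a <= _).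
  apply: le_Rintegral => //.
  - apply: (@antitone_integrable _ a b) => x /=; rewrite !in_itv /=.
    by move=> /andP[/ltW -> ->].
  - apply: (@integrableS _ _ _ mu `[a, b]%classic) => //.
      by move=> x /=; rewrite !in_itv /= => /andP[/ltW -> ->].
    apply: measurable_bounded_integrable => //.
      by rewrite /= lebesgue_measure_itv; case: ifP => _; rewrite ?ltry // -EFinB ltry.
    by exists (F a); split=> [|y Fy x _] /=; [exact: num_real|rewrite ger0_norm // ltW].
  - by move=> x /=; rewrite in_itv /= => /andP[/ltW ax _]; exact: F_anti.
rewrite Rintegral_cst // mulrC ler_wpM2r // /= lebesgue_measure_itv /= lte_fin.
by case: ifP => // _ /=; rewrite subr_ge0.
Qed.

(** If a relation [H] between a time and an exponent can be propagated by explicit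
    steps whose increment uses the value of [F] at the end of the step, then it
    reaches lower Riemann sums, hence exponents arbitrarily close to the
    integral. The steps start at a positive time, because the heat flow of a
    function with zeros is positive only there. *)
Lemma antitone_integral_ind (H : R -> R -> Prop) :
  (forall s, 0 < s -> H s 0) ->
  (forall s s' e, 0 < s -> s <= s' -> 0 <= e -> H s e ->
    H s' (e + F s' * (s' - s))) ->
  forall t eps, 0 < t -> 0 < eps -> exists e, [/\ 0 <= e, I t - eps <= e & H t e].
Proof.
move=> H0 HS t eps t0 e0.
(* On the grid of step [d], the error is [F 0 - F s] per unit [d] because [F]
   decreases, plus [F 0] for the first step, where the exponent stays [0]. *)
pose N := (Num.truncn (2 * F 0 * t / eps)).
pose d := t / N.+1%:R.
have N0 : 0 < N.+1%:R :> R by rewrite ltr0n.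
have d0 : 0 < d by rewrite divr_gt0.
have step k : exists e, [/\ 0 <= e,
    I (k.+1%:R * d) - d * (2 * F 0 - F (k.+1%:R * d)) <= e & H (k.+1%:R * d) e].
  elim: k => [|k [e [e_ge0 Ie He]]].
    exists 0; rewrite mul1r; split => //; last exact: H0.
    have := antitone_integral_le (lexx 0) (ltW d0).
    rewrite set_itv1 Rintegral_set1 add0r subr0.
    have := ler_wpM2l (ltW d0) (F_anti (ltW d0)).
    by lra.
  exists (e + F (k.+2%:R * d) * (k.+2%:R * d - k.+1%:R * d)).
  have kd : k.+2%:R * d - k.+1%:R * d = d.
    by rewrite -mulrBl -natrB // subSnn mul1r.
  have k0 : 0 < k.+1%:R * d by rewrite mulr_gt0 // ltr0n.
  have kk : k.+1%:R * d <= k.+2%:R * d by rewrite ler_pM2r // ler_nat.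
  split; last exact: HS.
    by rewrite addr_ge0 // mulr_ge0 // kd ltW.
  have := antitone_integral_le (ltW k0) kk.
  by rewrite kd; lra.
have [e [e_ge0 Ie He]] := step N.
have Nd : N.+1%:R * d = t by rewrite /d mulrC divfK // gt_eqF.
exists e; rewrite Nd in Ie He; split=> //; apply: le_trans Ie.
have : 2 * F 0 * t / eps < N.+1%:R by exact: truncnS_gt.
rewrite ltr_pdivrMr // -ltr_pdivrMl //.
have -> : N.+1%:R^-1 * (2 * F 0 * t) = d * (2 * F 0) by rewrite /d; ring.
have : 0 <= d * F t by rewrite mulr_ge0 // ltW.
by lra.
Qed.

End antitone_integral.

(** * Hypercontractivity *)

Section rate.
Context {R : realType}.
Variable rho0 : R.
Hypothesis rho0P : 0 <= rho0 <= ln 2 / 2.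

Lemma rho_tildeE (s : R) : rho_tilde rho0 s = 2 * rho0 + ln ((1 + expR (- (2 * s))) / 2).
Proof.
have e0 := expR_gt0 (- (2 * s)); rewrite /rho_tilde; congr (_ + _).
by rewrite -lnV ?posrE ?invf_div // divr_gt0 // addr_gt0.
Qed.

Lemma rho_tilde_le (s s' : R) : s <= s' -> rho_tilde rho0 s' <= rho_tilde rho0 s.
Proof.
move=> ss; have e0 := expR_gt0 (- (2 * s)); have e1 := expR_gt0 (- (2 * s')).
rewrite !rho_tildeE lerD2l ler_ln ?posrE ?divr_gt0 ?addr_gt0 //.
by rewrite ler_pM2r ?invr_gt0 // lerD2l ler_expR; lra.
Qed.

Definition entropy_level (s : R) : R := Num.max (rho_tilde rho0 s) 0.

Lemma entropy_level_lt (s : R) : 0 < s -> 0 <= entropy_level s < ln 2.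
Proof.
move=> s0; rewrite /entropy_level le_max lexx orbT gt_max.
have l2 : 0 < ln 2 :> R by rewrite ln_gt0 // ltr1n.
rewrite l2 andbT rho_tildeE.
have e0 := expR_gt0 (- (2 * s)).
have e1 : expR (- (2 * s)) < 1 by rewrite expR_lt1; lra.
suff : ln ((1 + expR (- (2 * s))) / 2) < 0 by case/andP: rho0P; lra.
by apply: ln_lt0; apply/andP; split; lra.
Qed.

Lemma entropy_level_le (s s' : R) : s <= s' -> entropy_level s' <= entropy_level s.
Proof. by move=> ss; rewrite /entropy_level le_max2 // rho_tilde_le. Qed.

Lemma entropy_level_le_ln2 (s : R) : 0 <= s -> entropy_level s <= ln 2.
Proof.
move=> s0; apply: le_trans (entropy_level_le s0) _.
have l2 : 0 < ln 2 :> R by rewrite ln_gt0 // ltr1n.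
rewrite /entropy_level ge_max (ltW l2) andbT rho_tildeE mulr0 oppr0 expR0.
have -> : (1 + 1) / 2 = 1 :> R by lra.
by rewrite ln1; case/andP: rho0P; lra.
Qed.

(** Extended by a constant to negative times, to be decreasing on the line. *)
Definition rate (s : R) : R := Cfun (entropy_level (Num.max s 0)).

Lemma rate_anti : nonincreasing_fun rate.
Proof.
move=> s s' ss; apply: Cfun_le.
- by rewrite /entropy_level le_max lexx orbT.
- by apply: entropy_level_le; rewrite le_max2.
- by apply: entropy_level_le_ln2; rewrite le_max lexx orbT.
Qed.

Lemma rate_ge0 (s : R) : 0 <= rate s.
Proof.
have l2 : 0 < ln 2 :> R by rewrite ln_gt0 // ltr1n.
apply: (@le_trans _ _ (Cfun 0)); first by rewrite /Cfun eqxx.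
apply: Cfun_le => //; first by rewrite /entropy_level le_max lexx orbT.
by apply: entropy_level_le_ln2; rewrite le_max lexx orbT.
Qed.

Lemma p_exp_rate (t : R) :
  p_exp rho0 t = 1 + expR (\int[lebesgue_measure]_(s in `[0, t]) rate s).
Proof.
have E : {in `[0, t]%classic, (fun s => Cfun (Num.max (rho_tilde rho0 s) 0)) =1 rate}.
  move=> s; rewrite inE /= in_itv /= => /andP[s0 _].
  by rewrite /rate /entropy_level (max_idPl s0).
rewrite /p_exp; have := @eq_Rintegral _ _ R (@lebesgue_measure R) _ _ _ E.
by move=> /= ->.
Qed.

End rate.

Section hypercontractivity.
Context {R : realType} {n : nat}.
Variables (rho0 : R) (f : cube n -> R).
Hypotheses (f_ge0 : forall x, 0 <= f x)
  (hf : expR (n%:R * rho0) * pnorm 1 f <= pnorm 2 f).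

Lemma pnorm1E : pnorm 1 f = expect f.
Proof.
rewrite /pnorm invr1 powRr1.
  by apply: eq_expect => x; rewrite powRr1 // ger0_norm.
by rewrite /expect mulr_ge0 ?invr_ge0 ?exprn_ge0 // sumr_ge0 // => x _; rewrite powR_ge0.
Qed.

Lemma pnorm2E (g : cube n -> R) : pnorm 2 g = expect (fun x => g x ^+ 2) `^ 2^-1.
Proof.
rewrite /pnorm; congr (_ `^ _); apply: eq_expect => x.
by rewrite powR_mulrn // real_normK // num_real.
Qed.

Lemma pnorm2_cube_noise_le (t : R) : 0 <= t -> pnorm 2 (cube_noise t f) <= pnorm 2 f.
Proof.
have ge0 (g : cube n -> R) : 0 <= expect (fun x => g x ^+ 2).
  rewrite /expect mulr_ge0 ?invr_ge0 ?exprn_ge0 // sumr_ge0 // => x _.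
  exact: sqr_ge0.
move=> t0; rewrite !pnorm2E ge0_ler_powR ?nnegrE ?invr_ge0 //.
by rewrite ler_pM2l ?invr_gt0 ?exprn_gt0 // sum_cube_noise_sqr_le.
Qed.

Hypothesis f_neq0 : exists x, f x != 0.

(** The heat flow preserves the first moment and keeps at least the diagonal part
    of the second one, so the ratio of the two norms, and with it the entropy of
    every power [p] at least [2], stays above the level [rho_tilde]. *)
Lemma entropy_level_entropy (s p : R) : 0 < s -> 2 <= p ->
  let v x := ln (cube_noise s f x) in
  n%:R * entropy_level rho0 s <= p * tilted_mean v p - log_moment v p.
Proof.
move=> s0 p2 /=; set v : cube n -> R := fun x => ln (cube_noise s f x).
rewrite /entropy_level; have [_|_] := leP (rho_tilde rho0 s) 0.
  by rewrite mulr0 tilted_entropy_ge0.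
apply: le_trans (tilted_entropy_ge v p2).
have g0 x : 0 < cube_noise s f x by exact: cube_noise_gt0.
have E1 : log_moment v 1 = ln (expect f).
  rewrite /log_moment; congr ln; rewrite /expect -(sum_cube_noise s f).
  by congr (_ * _); apply: eq_bigr => x _; rewrite mul1r lnK // posrE.
have E2 : log_moment v 2 = ln (expect (fun x => cube_noise s f x ^+ 2)).
  rewrite /log_moment; congr ln; apply: eq_expect => x.
  by rewrite mulr2n mulrDl mul1r expRD lnK ?posrE // expr2.
have [x0 fx0] := f_neq0.
have N0 : 0 < (2 ^+ n)^-1 :> R by rewrite invr_gt0 exprn_gt0.
have f1 : 0 < expect f.
  rewrite mulr_gt0 // (bigD1 x0) //= ltr_pwDl ?lt_neqAle 1?eq_sym ?fx0 ?f_ge0 //.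
  by apply: sumr_ge0.
have f2 : 0 < expect (fun x => f x ^+ 2).
  rewrite mulr_gt0 // (bigD1 x0) //= ltr_pwDl ?exprn_even_gt0 //.
  by apply: sumr_ge0 => x _; exact: sqr_ge0.
have hl : n%:R * rho0 + ln (expect f) <= 2^-1 * ln (expect (fun x => f x ^+ 2)).
  have e0 := expR_gt0 (n%:R * rho0).
  move: hf; rewrite pnorm1E pnorm2E => h.
  rewrite -ln_powR -[X in X + _]expRK -lnM ?posrE //.
  by rewrite ler_ln ?posrE ?powR_gt0 ?(mulr_gt0 e0 f1).
have e0 := expR_gt0 (- (2 * s)).
have a0 : 0 < (1 + expR (- (2 * s))) / 2 by rewrite divr_gt0 // addr_gt0.
have hg : n%:R * ln ((1 + expR (- (2 * s))) / 2) + ln (expect (fun x => f x ^+ 2))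
    <= log_moment v 2.
  have an0 : 0 < ((1 + expR (- (2 * s))) / 2) ^+ n by rewrite exprn_gt0.
  rewrite mulr_natl -lnXn // -lnM ?posrE // E2.
  rewrite ler_ln ?posrE ?(mulr_gt0 an0 f2) //; last first.
    by apply: expect_gt0 => x; rewrite exprn_gt0.
  rewrite /expect mulrCA ler_pM2l //.
  by apply: sum_cube_noise_sqr_ge => //; exact: ltW.
by rewrite rho_tildeE E1; lra.
Qed.

End hypercontractivity.

Lemma pnorm_continuous_exponent {R : realType} {n : nat} (g : cube n -> R) (a : R) :
  (forall x, 0 < g x) -> {for a, continuous (fun e : R => pnorm (1 + expR e) g)}.
Proof.
move=> g0; pose v x := ln (g x).
have -> : (fun e : R => pnorm (1 + expR e) g) =
    (fun e => expR (log_moment v (1 + expR e) / (1 + expR e))).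
  by apply/funext => e; rewrite pnorm_log_moment // addr_gt0 ?expR_gt0.
have e0 := expR_gt0 a; have pN : 1 + expR a != 0 by rewrite gt_eqF // addr_gt0.
have dp : is_derive a 1 (fun e => 1 + expR e : R) (expR a).
  by apply: is_derive_eq; rewrite /GRing.scale /=; ring.
have dv x : is_derive a 1 ((fun=> v) ^~ x : R -> R) 0 by exact: is_derive_cst.
have H1 := is_derive_log_moment dv dp.
have H2 : is_derive a 1 (fun e => (1 + expR e)^-1) (- (1 + expR a) ^- 2 *: expR a).
  exact: is_deriveV.
apply: (@continuous_comp _ _ _ (fun e => log_moment v (1 + expR e) / (1 + expR e)) expR).
  apply/differentiable_continuous/derivable1_diffP.
  by apply: derivableM; apply: ex_derive.
exact: continuous_expR.
Qed.

(** The stepwise decay reaches exponents [1 + expR e] with [e] arbitrarily close to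
    the integral of the rate; norms increase with the exponent and depend
    continuously on it. *)
Lemma pnorm_flow_p_exp {R : realType} {n : nat} (rho0 : R) (f : cube n -> R) (t : R) :
  0 <= rho0 <= ln 2 / 2 -> (forall x, 0 <= f x) ->
  expR (n%:R * rho0) * pnorm 1 f <= pnorm 2 f -> (exists x, f x != 0) -> 0 < t ->
  pnorm (p_exp rho0 t) (cube_noise t f) <= pnorm 2 f.
Proof.
move=> rho0P f_ge0 hf fN t0.
have g0 s x : 0 < s -> 0 < cube_noise s f x by move=> s0; exact: cube_noise_gt0.
pose H s e := pnorm (1 + expR e) (cube_noise s f) <= pnorm 2 f.
have H0 s : 0 < s -> H s 0.
  move=> s0; rewrite /H expR0 -[1 + 1]/(2 : R).
  by apply: pnorm2_cube_noise_le => //; exact: ltW.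
have HS s s' e : 0 < s -> s <= s' -> 0 <= e -> H s e ->
    H s' (e + rate rho0 s' * (s' - s)).
  move=> s0 ss e0; apply: le_trans.
  have s'0 : 0 < s' by exact: lt_le_trans ss.
  have q2 : 2 <= 1 + expR e by have := expR_ge1Dx e; lra.
  have := @pnorm_flow_le R n f (entropy_level rho0 s') _ s s' f_ge0 fN s0 ss q2
    (entropy_level_lt rho0P s'0).
  rewrite addrAC subrr add0r -expRD /rate (max_idPl (ltW s'0)); apply.
  move=> r p /andP[sr rs] p2 /=.
  have r0 : 0 < r by exact: lt_le_trans sr.
  apply: le_trans (entropy_level_entropy f_ge0 hf fN r0 p2).
  by rewrite ler_wpM2l // entropy_level_le.
rewrite p_exp_rate; set G := (\int[_]_(_ in _) _).
rewrite leNgt; apply/negP => lt.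
have := pnorm_continuous_exponent (a := G) (fun x => g0 t x t0).
move=> /cvgr_gt /(_ _ lt) /nbhs_ballP[d /= d0 near].
have d20 : 0 < d / 2 by rewrite divr_gt0.
have [e [e0 Ge He]] := antitone_integral_ind (rate_anti rho0P) (rate_ge0 rho0P) H0 HS t0 d20.
have {near} : pnorm 2 f < pnorm (1 + expR (G - d / 2)) (cube_noise t f).
  by apply: near; rewrite /ball /= opprB addrC subrK gtr0_norm //; lra.
rewrite ltNge => /negP; apply; apply: le_trans He.
have p0 (c : R) : 0 < 1 + expR c by rewrite addr_gt0 // expR_gt0.
rewrite !pnorm_log_moment //; try by move=> x; exact: g0.
by rewrite ler_expR log_moment_ratio_le // lerD2l ler_expR.
Qed.

Lemma pnorm0 {R : realType} {n : nat} (p : R) (g : cube n -> R) : p != 0 ->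
  (forall x, g x = 0) -> pnorm p g = 0.
Proof.
move=> pN g0; rewrite /pnorm.
under eq_expect do rewrite g0 normr0 powR0 //.
by rewrite expect_cst powR0 // invr_eq0.
Qed.

Theorem theorem8 (R : realType) (rho0 : R) (hrho0 : 0 <= rho0 <= ln 2 / 2)
  (n : nat) (hn : (1 <= n)%N) (f : cube n -> R) (f_ge0 : forall x, 0 <= f x)
  (hf : expR (n%:R * rho0) * pnorm 1 f <= pnorm 2 f) (t : R) (ht : 0 <= t) :
  pnorm (p_exp rho0 t) (cube_noise t f) <= pnorm 2 f.
Proof.
have [fN|f0] := pselect (exists x, f x != 0); last first.
  rewrite pnorm0 ?powR_ge0 //.
    by rewrite gt_eqF // /p_exp addr_gt0 // expR_gt0.
  move=> x; rewrite cube_noiseE big1 // => y _.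
  by have [->|fy] := eqVneq (f y) 0; [rewrite mulr0|case: f0; exists y].
move: ht; rewrite le_eqVlt => /predU1P[<-|t0]; last exact: pnorm_flow_p_exp.
rewrite /p_exp set_itv1 Rintegral_set1 expR0 -[1 + 1]/(2 : R).
exact: pnorm2_cube_noise_le.
Qed.
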